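(* Let $A\in\mathbb{R}^{n\times n}$ be positive definite and $b\in\mathbb{R}^n$. Let $\hat r_k,\hat p_k$ be produced by FOM and $r_k,p_k$ be produced by SCG (both applied to $Ax=b$ with zero initial point, in exact arithmetic). Then for all $k\ge 1$, if $\hat r_{k-1}\neq 0$ and $r_{k-1}\neq 0$, there exists a scalar $a_{k-1}\neq 0$ such that $$\hat p_k = a_{k-1}\,p_{k-1}\qquad\text{and}\qquad \hat r_k = r_k .$$
   Context: A real square (not necessarily symmetric) matrix $A$ is positive definite if $x^TAx>0$ for all nonzero $x\in\mathbb{R}^n$. $\|\cdot\|$ is the 2-norm, $e_k$ is the $k$th column of an identity matrix. SCG (semi-conjugate gradient method). Set $x_0=0$, $r_0=b$, $p_0=r_0$, $q_0=Ap_0$. For $k=0,1,2,\dots$: compute $\alpha_k = p_k^Tr_k/(p_k^Tq_k)$, $x_{k+1}=x_k+\alpha_kp_k$, $r_{k+1}=r_k-\alpha_kq_k$; form $v_{k+1}=Ar_{k+1}$, $P_{k+1}=[p_0\ p_1\ \cdots\ p_k]$, $Q_{k+1}=[q_0\ q_1\ \cdots\ q_k]$, $L_{k+1}=P_{k+1}^TQ_{k+1}$, solve $L_{k+1}\lambda_{k+1}=P_{k+1}^Tv_{k+1}$ and set $p_{k+1}=r_{k+1}-P_{k+1}\lambda_{k+1}$, $q_{k+1}=v_{k+1}-Q_{k+1}\lambda_{k+1}$. The method stops as soon as $r_k=0$. FOM (full orthogonalization method). Set $\hat x_0=0$, $\hat r_0=b$, $\beta=\|\hat r_0\|$, $\hat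 v_1=\hat r_0/\beta$. Step $k=1,2,\dots$ consists of: (1) Arnoldi process: $h_{ik}=\hat v_i^TA\hat v_k$ for $i=1,\dots,k$, $w_k=A\hat v_k-\sum_{i=1}^k h_{ik}\hat v_i$, $h_{k+1,k}=\|w_k\|$, and $\hat v_{k+1}=w_k/h_{k+1,k}$ if $h_{k+1,k}\ne0$. (2) Let $H_k=(h_{ij})_{1\le i,j\le k}$ (upper Hessenberg, with $h_{ij}=0$ for $i>j+1$). Since $H_k=\hat V_k^TA\hat V_k$ with $\hat V_k=[\hat v_1\cdots\hat v_k]$ having orthonormal columns, $H_k$ is positive definite and has an LU factorization without pivoting $H_k=\hat L_k\hat U_k$, $\hat L_k=(l_{ij})$ unit lower triangular, $\hat U_k=(u_{ij})$ upper triangular with positive diagonal (the factors for $k-1$ are the leading blocks of those for $k$). (3) $\zeta_1=\beta$, and $\zeta_k=-l_{k,k-1}\zeta_{k-1}$ for $k>1$. (4) $\hat p_k=\bigl(\hat v_k-\sum_{i=1}^{k-1}u_{ik}\hat p_i\bigr)/u_{kk}$. (5) $\hat x_k=\hat x_{k-1}+\zeta_k\hat p_k$ and $\hat r_k=\hat r_{k-1}-\zeta_kA\hat p_k$. The method stops as soon as $\hat r_k=0$. In the statement, $\hat r_{k-1}$ and $r_{k-1}$ refer to vectors actually produced by these methods, i.e. the methods have not stopped before producing them. *)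

(* Defs.v *)
From HB Require Import structures.
From mathcomp Require Import all_boot all_order all_algebra.
From mathcomp Require Import reals.

Set Implicit Arguments.
Unset Strict Implicit.
Unset Printing Implicit Defensive.

Import Order.TTheory GRing.Theory Num.Theory.

Local Open Scope ring_scope.

Section Methods.

Variables (R : realType) (n : nat).
Implicit Types (x y : 'cV[R]_n) (A : 'M[R]_n).

Definition dot x y : R := (x^T *m y) 0 0.

(* The 2-norm; the norm that mathcomp-analysis puts on matrices is the
   max-norm. *)
Definition norm2 x : R := Num.sqrt (dot x x).

(* No symmetry is required of [A]. *)
Definition posdef A : Prop := forall x, x != 0 -> 0 < dot x (A *m x).

(* The n x k matrix [p_0 p_1 ... p_(k-1)]. *)
Definition colseq (p : nat -> 'cV[R]_n) (k : nat) : 'M[R]_(n, k) :=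
  \matrix_(i < n, j < k) p j i 0.

(* The leading k x k block of a doubly indexed family whose indices start
   at 1. *)
Definition leadmx (h : nat -> nat -> R) (k : nat) : 'M[R]_k :=
  \matrix_(i < k, j < k) h i.+1 j.+1.

(* [is_trig_mx] means lower triangular. *)
Definition LU_factorization k (H L U : 'M[R]_k) : Prop :=
  [/\ H = L *m U,
      is_trig_mx L, forall i, L i i = 1,
      is_trig_mx U^T & forall i, 0 < U i i].

(* A method that stops at the first zero residual computes [r k] exactly when
   none of the earlier residuals vanishes. *)
Definition produced (r : nat -> 'cV[R]_n) (k : nat) : Prop :=
  forall j, (j < k)%N -> r j != 0.

(* A run is stored in total sequences; entries that the method does not
   compute before it stops are left unconstrained. *)
Record SCG_run (A : 'M[R]_n) (b : 'cV[R]_n) := SCGRun {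
  scg_x : nat -> 'cV[R]_n;
  scg_r : nat -> 'cV[R]_n;
  scg_p : nat -> 'cV[R]_n;
  scg_q : nat -> 'cV[R]_n;
  scg_init : [/\ scg_x 0%N = 0, scg_r 0%N = b, scg_p 0%N = scg_r 0%N
               & scg_q 0%N = A *m scg_p 0%N];
  scg_update : forall k, produced scg_r k.+1 ->
    let alpha := dot (scg_p k) (scg_r k) / dot (scg_p k) (scg_q k) in
    scg_x k.+1 = scg_x k + alpha *: scg_p k /\
    scg_r k.+1 = scg_r k - alpha *: scg_q k;
  scg_direction : forall k, produced scg_r k.+1 -> scg_r k.+1 != 0 ->
    let v := A *m scg_r k.+1 in
    let P := colseq scg_p k.+1 in
    let Q := colseq scg_q k.+1 in
    let L := P^T *m Q in
    exists lambda : 'cV[R]_k.+1,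
      [/\ L *m lambda = P^T *m v,
          scg_p k.+1 = scg_r k.+1 - P *m lambda
        & scg_q k.+1 = v - Q *m lambda]
}.

(* Indices are those of the mathematics: [x] and [r] start at 0, and the other
   sequences start at 1 (their values at index 0 are irrelevant). *)
Record FOM_run (A : 'M[R]_n) (b : 'cV[R]_n) := FOMRun {
  fom_v : nat -> 'cV[R]_n;
  fom_h : nat -> nat -> R;
  fom_l : nat -> nat -> R;
  fom_u : nat -> nat -> R;
  fom_zeta : nat -> R;
  fom_p : nat -> 'cV[R]_n;
  fom_x : nat -> 'cV[R]_n;
  fom_r : nat -> 'cV[R]_n;
  fom_init : [/\ fom_x 0%N = 0, fom_r 0%N = b
               & fom_r 0%N != 0 ->
                 fom_v 1%N = (norm2 (fom_r 0%N))^-1 *: fom_r 0%N];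
  fom_arnoldi : forall k, (0 < k)%N -> produced fom_r k ->
    let w := A *m fom_v k - \sum_(1 <= i < k.+1) fom_h i k *: fom_v i in
    [/\ forall i, (0 < i <= k)%N -> fom_h i k = dot (fom_v i) (A *m fom_v k),
        fom_h k.+1 k = norm2 w,
        fom_h k.+1 k != 0 -> fom_v k.+1 = (fom_h k.+1 k)^-1 *: w
      & forall i, (k.+1 < i)%N -> fom_h i k = 0];
  fom_LU : forall k, (0 < k)%N -> produced fom_r k ->
    LU_factorization (leadmx fom_h k) (leadmx fom_l k) (leadmx fom_u k);
  fom_zeta_step : forall k, (0 < k)%N -> produced fom_r k ->
    fom_zeta k = if k == 1%N then norm2 (fom_r 0%N)
                 else - fom_l k k.-1 * fom_zeta k.-1;
  fom_direction : forall k, (0 < k)%N -> produced fom_r k ->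
    fom_p k = (fom_u k k)^-1 *:
                (fom_v k - \sum_(1 <= i < k) fom_u i k *: fom_p i);
  fom_update : forall k, (0 < k)%N -> produced fom_r k ->
    fom_x k = fom_x k.-1 + fom_zeta k *: fom_p k /\
    fom_r k = fom_r k.-1 - fom_zeta k *: (A *m fom_p k)
}.

End Methods.

(* Main.v *)
Require Import Defs.
From HB Require Import structures.
From mathcomp Require Import all_boot all_order all_algebra.
From mathcomp Require Import reals.

Import Order.TTheory GRing.Theory Num.Theory.

Local Open Scope ring_scope.

(** Since [H_k] is upper Hessenberg, its factor [L_k] is bidiagonal, which turns
the Arnoldi relation into [A p^_k = v^_k + w_k / u_kk]. As [w_k] is orthogonal
to [v^_1, ..., v^_k], the FOM directions are semi-conjugate and [r^_k], a
multiple of [w_k], is orthogonal to [p^_k]; moreover [r^_(k-1) = zeta_k v^_k].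
The SCG directions are semi-conjugate by construction. By induction,
[d := p^_k - p_(k-1) / (zeta_k u_kk)] lies in the span of the earlier directions,
all of which are orthogonal to [A d]; so [d^T A d = 0] and [d = 0]. Both methods
then take the step along this common line that makes the new residual orthogonal
to it, so the residuals agree. *)

(** * Dot product and 2-norm *)

Section Dot.
Set Implicit Arguments.
Unset Strict Implicit.
Variables (R : realType) (n : nat).
Implicit Types (x y z : 'cV[R]_n) (A : 'M[R]_n).

Lemma dotE x y : dot x y = \sum_i x i 0 * y i 0.
Proof. by rewrite /dot mxE; apply: eq_bigr => i _; rewrite mxE. Qed.

Lemma dotC x y : dot x y = dot y x.
Proof. by rewrite !dotE; apply: eq_bigr => i _; rewrite mulrC. Qed.

Lemma dotDr x y z : dot x (y + z) = dot x y + dot x z.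
Proof. by rewrite /dot mulmxDr mxE. Qed.

Lemma dotZr a x y : dot x (a *: y) = a * dot x y.
Proof. by rewrite /dot -scalemxAr mxE. Qed.

Lemma dotBr x y z : dot x (y - z) = dot x y - dot x z.
Proof. by rewrite -scaleN1r dotDr dotZr mulN1r. Qed.

Lemma dot0r x : dot x 0 = 0.
Proof. by rewrite /dot mulmx0 mxE. Qed.

Lemma dotZl a x y : dot (a *: x) y = a * dot x y.
Proof. by rewrite dotC dotZr dotC. Qed.

Lemma dotBl x y z : dot (x - y) z = dot x z - dot y z.
Proof. by rewrite !(dotC _ z) dotBr. Qed.

Lemma dot_sumr (I : Type) (s : seq I) (P : pred I) (F : I -> 'cV[R]_n) x :
  dot x (\sum_(i <- s | P i) F i) = \sum_(i <- s | P i) dot x (F i).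
Proof. by apply: (big_morph (dot x)); [exact: dotDr | exact: dot0r]. Qed.

Lemma dot_ge0 x : 0 <= dot x x.
Proof. by rewrite dotE; apply: sumr_ge0 => i _; rewrite -expr2 sqr_ge0. Qed.

Lemma dot_eq0 x : dot x x = 0 -> x = 0.
Proof.
rewrite dotE => /psumr_eq0P x0; apply/colP => i; rewrite mxE.
apply/eqP; rewrite -sqrf_eq0 expr2; apply/eqP/x0 => // j _.
by rewrite -expr2 sqr_ge0.
Qed.

Lemma sqr_norm2 x : norm2 x ^+ 2 = dot x x.
Proof. by rewrite /norm2 sqr_sqrtr // dot_ge0. Qed.

Lemma norm2_eq0 x : norm2 x = 0 -> x = 0.
Proof. by move=> x0; apply: dot_eq0; rewrite -sqr_norm2 x0 expr0n. Qed.

Lemma posdef_dot_eq0 A x : posdef A -> dot x (A *m x) = 0 -> x = 0.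
Proof.
by move=> hA x0; apply/eqP; apply: contraT => /hA; rewrite x0 ltxx.
Qed.

Lemma colseq_mulmx (p : nat -> 'cV[R]_n) k (c : 'cV[R]_k) :
  colseq p k *m c = \sum_(j < k) c j 0 *: p j.
Proof.
apply/colP => i; rewrite mxE summxE; apply: eq_bigr => j _.
by rewrite !mxE mulrC.
Qed.

Lemma tr_colseq_mulmx (p : nat -> 'cV[R]_n) k x (j : 'I_k) :
  ((colseq p k)^T *m x) j 0 = dot (p j) x.
Proof. by rewrite mxE dotE; apply: eq_bigr => i _; rewrite !mxE. Qed.

End Dot.

(** * LU factors of an upper Hessenberg matrix *)

Section LeadingLU.
Set Implicit Arguments.
Unset Strict Implicit.
Variables (R : realType) (k : nat) (h l u : nat -> nat -> R).
Hypothesis hLU : LU_factorization (leadmx h k) (leadmx l k) (leadmx u k).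

Lemma LU_entry i j : (i < k)%N -> (j < k)%N ->
  h i.+1 j.+1 = \sum_(m < k) l i.+1 m.+1 * u m.+1 j.+1.
Proof.
move=> ik jk; case: hLU => /matrixP /(_ (Ordinal ik) (Ordinal jk)) + _ _ _ _.
by rewrite !mxE /= => ->; apply: eq_bigr => m _; rewrite !mxE.
Qed.

Lemma LU_lower_eq0 i j : (i < j)%N -> (j < k)%N -> l i.+1 j.+1 = 0.
Proof.
move=> ij jk; case: hLU => _ /is_trig_mxP/(_ (Ordinal (ltn_trans ij jk))).
by move/(_ (Ordinal jk) ij); rewrite mxE.
Qed.

Lemma LU_upper_eq0 i j : (j < i)%N -> (i < k)%N -> u i.+1 j.+1 = 0.
Proof.
move=> ji ik; case: hLU => _ _ _ /is_trig_mxP/(_ (Ordinal (ltn_trans ji ik))).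
by move=> /(_ (Ordinal ik) ji); rewrite !mxE.
Qed.

Lemma LU_lower_diag i : (i < k)%N -> l i.+1 i.+1 = 1.
Proof. by move=> ik; case: hLU => _ _ /(_ (Ordinal ik)); rewrite mxE. Qed.

Lemma LU_upper_diag_gt0 i : (i < k)%N -> 0 < u i.+1 i.+1.
Proof. by move=> ik; case: hLU => _ _ _ _ /(_ (Ordinal ik)); rewrite mxE. Qed.

Hypothesis hess : forall i j, (j.+1 < i)%N -> (i < k)%N -> h i.+1 j.+1 = 0.

(** Induction on the column. In the product expansion of the zero entry of [h], earlier columns of
    [l] vanish by induction and later terms by triangularity of [u]. What remains is the wanted
    entry times a positive pivot. *)
Lemma LU_lower_bidiag i j : (j.+1 < i)%N -> (i < k)%N -> l i.+1 j.+1 = 0.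
Proof.
elim/ltn_ind: j i => j IH i ji ik.
have jk : (j < k)%N by apply: ltn_trans ik; apply: ltnW.
have := LU_entry ik jk; rewrite hess // (bigD1 (Ordinal jk)) //= big1.
  rewrite addr0 => /esym/eqP; rewrite mulf_eq0.
  by rewrite (gt_eqF (LU_upper_diag_gt0 jk)) orbF => /eqP.
move=> m; rewrite -val_eqE /= => mj.
have [lt_mj|le_jm] := ltnP m j.
  by rewrite IH ?mul0r //; apply: ltn_trans ji.
by rewrite LU_upper_eq0 ?mulr0 // ltn_neqAle eq_sym mj.
Qed.

Lemma LU_bidiag_entry i j : (i < k)%N -> (j < k)%N ->
  h i.+1 j.+1 =
    u i.+1 j.+1 + (if i is i'.+1 then l i'.+2 i'.+1 * u i'.+1 j.+1 else 0).
Proof.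
move=> ik jk; rewrite (LU_entry ik jk) (bigD1 (Ordinal ik)) //=.
rewrite LU_lower_diag // mul1r; congr (_ + _).
case: i ik => [|i] ik.
  by apply: big1 => m; rewrite -val_eqE /= -lt0n => m0; rewrite LU_lower_eq0 ?mul0r.
have ik' := ltnW ik.
rewrite (bigD1 (Ordinal ik')) /=; last by rewrite -val_eqE /= neq_ltn ltnSn.
rewrite big1 ?addr0 // => m; rewrite -!val_eqE /= => /andP[m1 m2].
have [lt_mi|le_im] := ltnP m i; first by rewrite LU_lower_bidiag ?mul0r.
rewrite LU_lower_eq0 ?mul0r // ltn_neqAle eq_sym m1.
by rewrite ltn_neqAle eq_sym m2.
Qed.

Lemma LU_subdiag_entry j : (j.+1 < k)%N -> h j.+2 j.+1 = l j.+2 j.+1 * u j.+1 j.+1.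
Proof.
by move=> jk; rewrite LU_bidiag_entry ?(ltnW jk) // LU_upper_eq0 // add0r.
Qed.

End LeadingLU.

Lemma producedW {R : realType} {n} {r : nat -> 'cV[R]_n} {j k} :
  (j <= k)%N -> produced r k -> produced r j.
Proof. by move=> jk rk i ij; apply: rk; apply: leq_trans jk. Qed.

(** * Arnoldi vectors, directions and residuals of FOM *)

Section FOM.
Set Implicit Arguments.
Unset Strict Implicit.
Variables (R : realType) (n : nat) (A : 'M[R]_n) (b : 'cV[R]_n).
Variable F : FOM_run A b.

Local Notation v := (fom_v F).
Local Notation h := (fom_h F).
Local Notation l := (fom_l F).
Local Notation u := (fom_u F).
Local Notation zeta := (fom_zeta F).
Local Notation p := (fom_p F).
Local Notation r := (fom_r F).

Definition arnoldi_residual k := A *m v k - \sum_(1 <= i < k.+1) h i k *: v i.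
Local Notation w := arnoldi_residual.

Lemma fom_hessenberg k : produced r k ->
  forall i j, (j.+1 < i)%N -> (i < k)%N -> h i.+1 j.+1 = 0.
Proof.
move=> rk i j ji ik; have [//|_ _ _ -> //] := @fom_arnoldi _ _ _ _ F j.+1 isT.
by apply: producedW rk; apply: ltnW; apply: ltn_trans ik.
Qed.

Lemma fom_u_gt0 k : produced r k.+1 -> 0 < u k.+1 k.+1.
Proof. by move=> rk; apply: (LU_upper_diag_gt0 (fom_LU (ltn0Sn k) rk)). Qed.

Lemma fom_subdiag k : produced r k.+2 -> h k.+2 k.+1 = l k.+2 k.+1 * u k.+1 k.+1.
Proof.
move=> rk; apply: (LU_subdiag_entry (fom_LU (ltn0Sn k.+1) rk)) => //.
exact: fom_hessenberg.
Qed.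

(** On breakdown [v k.+2] is unconstrained, but then both sides are zero. *)
Lemma arnoldi_residualE k : produced r k.+1 -> w k.+1 = h k.+2 k.+1 *: v k.+2.
Proof.
move=> rk; have [_ hw hv _] := fom_arnoldi (ltn0Sn k) rk.
have [h0|h0] := eqVneq (h k.+2 k.+1) 0; last first.
  by rewrite (hv h0) scalerA divff // scale1r.
by rewrite h0 scale0r; apply: norm2_eq0; rewrite /arnoldi_residual -hw.
Qed.

Lemma fom_v_decomp k : produced r k.+1 ->
  u k.+1 k.+1 *: p k.+1 = v k.+1 - \sum_(0 <= i < k) u i.+1 k.+1 *: p i.+1.
Proof.
move=> rk; rewrite (fom_direction (ltn0Sn k) rk) scalerA.
by rewrite divff ?gt_eqF ?fom_u_gt0 // scale1r big_add1.
Qed.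

(** In matrix form, [A V = V L U + w e_k^T] and [V = P U]; cancelling [U] gives
    [A P = V L + w e_k^T / u_kk], whose last column is the claim. *)
Lemma fom_A_direction k : produced r k.+1 ->
  A *m p k.+1 = v k.+1 + (u k.+1 k.+1)^-1 *: w k.+1.
Proof.
elim/ltn_ind: k => k IH rk; have u0 := fom_u_gt0 rk.
have Ap m : (m < k)%N -> A *m p m.+1 = v m.+1 + l m.+2 m.+1 *: v m.+2.
  move=> mk; have rm : produced r m.+2 by apply: producedW rk.
  have rm' : produced r m.+1 by apply: producedW rm.
  rewrite IH // arnoldi_residualE // fom_subdiag // scalerA mulrC mulfK //.
  by rewrite gt_eqF ?fom_u_gt0.
apply: (@scalerI _ _ (u k.+1 k.+1)); first by rewrite gt_eqF.
rewrite scalerDr scalerA divff ?gt_eqF // scale1r.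
rewrite scalemxAr fom_v_decomp // mulmxBr mulmx_sumr /arnoldi_residual.
rewrite big_add1 /=.
(* With [H = L U] and [L] bidiagonal, the sum is regrouped by columns of [V L]; all but the last are
   the vectors [A *m p i.+1] found in [Ap]. *)
have -> : \sum_(0 <= i < k.+1) h i.+1 k.+1 *: v i.+1 =
    u k.+1 k.+1 *: v k.+1 + \sum_(0 <= i < k) A *m (u i.+1 k.+1 *: p i.+1).
  rewrite (eq_big_nat _ _ (F2 := fun i => u i.+1 k.+1 *: v i.+1 +
    (if i is i'.+1 then l i'.+2 i'.+1 * u i'.+1 k.+1 else 0) *: v i.+1));
    last first.
    move=> i /= ik; rewrite -scalerDl; congr (_ *: _).
    apply: (LU_bidiag_entry (fom_LU (ltn0Sn k) rk)) => //.
    exact: fom_hessenberg.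
  rewrite big_split /= big_nat_recr //= big_nat_recl //= scale0r add0r.
  rewrite [X in X + _]addrC -addrA -big_split /=; congr (_ + _).
  apply: eq_big_nat => i /= ik.
  by rewrite -scalemxAr Ap // scalerDr scalerA mulrC.
by rewrite opprD addrCA addNKr.
Qed.

(** The step subtracts [zeta_k (v_k + l_(k+1,k) v_(k+1))] from [zeta_k v_k], leaving
    [- l_(k+1,k) zeta_k v_(k+1)]: this is the recurrence for [zeta]. *)
Lemma fom_residualE k : produced r k.+1 -> r k = zeta k.+1 *: v k.+1.
Proof.
elim: k => [|k IH] rk.
  rewrite (fom_zeta_step _ rk) //=; case: (fom_init F) => _ _ -> /=; last exact: rk.
  rewrite scalerA divff ?scale1r //.
  by apply/eqP => /norm2_eq0/eqP; apply/negP; apply: rk.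
have rk1 : produced r k.+1 by apply: producedW rk.
have [_ ->] := fom_update (ltn0Sn k) rk1; rewrite /= {1}IH //.
rewrite fom_A_direction // arnoldi_residualE // fom_subdiag //.
rewrite scalerA [_^-1 * _]mulrC mulfK ?gt_eqF ?fom_u_gt0 //.
rewrite scalerDr opprD addrA subrr add0r scalerA -scaleNr.
by rewrite (fom_zeta_step _ rk) //= mulNr mulrC.
Qed.

Lemma fom_residual_arnoldi k : produced r k.+1 ->
  r k.+1 = - (zeta k.+1 / u k.+1 k.+1) *: w k.+1.
Proof.
move=> rk; have [_ ->] := fom_update (ltn0Sn k) rk; rewrite /= fom_residualE //.
by rewrite fom_A_direction // scalerDr opprD addrA subrr add0r scalerA scaleNr.
Qed.

(** This is Gram-Schmidt. Orthonormality is a hypothesis because the lemma serves inside the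
    induction that proves it. *)
Lemma arnoldi_residual_orthogonal k j : produced r k.+1 ->
    (forall i j, (i <= k)%N -> (j <= k)%N -> dot (v i.+1) (v j.+1) = (i == j)%:R) ->
  (j <= k)%N -> dot (v j.+1) (w k.+1) = 0.
Proof.
move=> rk hO jk; have [harn _ _ _] := fom_arnoldi (ltn0Sn k) rk.
rewrite dotBr dot_sumr big_add1 /= big_mkord.
rewrite (bigD1 (Ordinal (n:=k.+1) (m:=j) jk)) //= dotZr hO // eqxx mulr1.
rewrite harn // big1 ?addr0 ?subrr // => i; rewrite -val_eqE /= => ij.
by rewrite dotZr (hO _ _ jk (ltn_ord i)) eq_sym (negbTE ij) mulr0.
Qed.

Lemma fom_orthonormal k : produced r k.+1 ->
  forall i j, (i <= k)%N -> (j <= k)%N -> dot (v i.+1) (v j.+1) = (i == j)%:R.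
Proof.
elim: k => [|k IH] rk i j.
  rewrite !leqn0 => /eqP-> /eqP->; rewrite eqxx.
  have r0 : r 0%N != 0 by apply: rk.
  have N0 : norm2 (r 0%N) != 0 by apply: contraNneq r0 => /norm2_eq0->.
  case: (fom_init F) => _ _ -> //.
  by rewrite dotZl dotZr -sqr_norm2 expr2 mulKf // mulVf.
have rk1 : produced r k.+1 by apply: producedW rk.
(* Arnoldi cannot break down here: a zero [w k.+1] would make the residual [r k.+1] vanish. *)
have hw0 : h k.+2 k.+1 != 0.
  have : r k.+1 != 0 by apply: rk.
  apply: contraNneq => h0.
  by rewrite fom_residual_arnoldi // arnoldi_residualE // h0 scale0r scaler0.
have [harn hw /(_ hw0) hv _] := fom_arnoldi (ltn0Sn k) rk1.
have vw m : (m <= k)%N -> dot (v m.+1) (v k.+2) = 0.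
  move=> mk; rewrite hv dotZr (_ : dot _ _ = 0) ?mulr0 //.
  by apply: arnoldi_residual_orthogonal => //; apply: IH.
rewrite (leq_eqVlt i) (leq_eqVlt j) !ltnS => /predU1P[->|ik] /predU1P[->|jk].
- by rewrite eqxx hv dotZl dotZr -sqr_norm2 -hw expr2 mulKf // mulVf.
- by rewrite dotC vw // gtn_eqF.
- by rewrite vw // ltn_eqF.
- exact: IH.
Qed.

Lemma dot_arnoldi_residual k j : produced r k.+1 -> (j <= k)%N ->
  dot (v j.+1) (w k.+1) = 0.
Proof.
by move=> rk; apply: arnoldi_residual_orthogonal => //; apply: fom_orthonormal.
Qed.

Lemma dot_fom_v_A_direction k j : produced r k.+1 -> (j <= k)%N ->
  dot (v j.+1) (A *m p k.+1) = (j == k)%:R.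
Proof.
move=> rk jk; rewrite fom_A_direction // dotDr dotZr dot_arnoldi_residual //.
by rewrite mulr0 addr0 (fom_orthonormal rk).
Qed.

Lemma fom_direction_neq0 k : produced r k.+1 -> p k.+1 != 0.
Proof.
move=> rk; apply/eqP => p0; have := dot_fom_v_A_direction rk (leqnn k).
by rewrite p0 mulmx0 dot0r eqxx => /eqP; rewrite eq_sym oner_eq0.
Qed.

(** Up to earlier directions, [p k.+1] is [v k.+1] divided by the pivot. *)
Lemma dot_fom_direction k y : produced r k.+1 ->
  (forall j, (j < k)%N -> dot (p j.+1) y = 0) ->
  dot (p k.+1) y = (u k.+1 k.+1)^-1 * dot (v k.+1) y.
Proof.
move=> rk py; apply: (@mulfI _ (u k.+1 k.+1)); first by rewrite gt_eqF ?fom_u_gt0.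
rewrite mulVKf ?gt_eqF ?fom_u_gt0 // -dotZl fom_v_decomp // dotBl.
rewrite (dotC (\sum_(_ <= _ < _) _)) dot_sumr big_nat_cond big1 ?subr0 // => j.
by rewrite andbT => /= jk; rewrite dotZr dotC py ?mulr0.
Qed.

Lemma fom_direction_orthogonal k y : produced r k.+1 ->
  (forall j, (j <= k)%N -> dot (v j.+1) y = 0) -> dot (p k.+1) y = 0.
Proof.
elim/ltn_ind: k => k IH rk vy.
rewrite dot_fom_direction ?vy ?mulr0 // => j jk.
apply: IH => // [|i ij]; first by apply: producedW rk; apply: ltnW.
by rewrite vy // (leq_trans ij) // ltnW.
Qed.

Lemma fom_semiconjugate k j : produced r k.+1 -> (j < k)%N ->
  dot (p j.+1) (A *m p k.+1) = 0.
Proof.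
move=> rk jk; apply: fom_direction_orthogonal => [|i ij].
  by apply: producedW rk; apply: ltnW.
have ik := leq_ltn_trans ij jk.
by rewrite dot_fom_v_A_direction ?(ltnW ik) // ltn_eqF.
Qed.

Lemma dot_fom_direction_residual k : produced r k.+1 -> dot (p k.+1) (r k.+1) = 0.
Proof.
move=> rk; apply: fom_direction_orthogonal => // j jk.
by rewrite fom_residual_arnoldi // dotZr dot_arnoldi_residual // mulr0.
Qed.

End FOM.

(** * Semi-conjugacy of the SCG directions *)

Section SCG.
Set Implicit Arguments.
Unset Strict Implicit.
Variables (R : realType) (n : nat) (A : 'M[R]_n) (b : 'cV[R]_n).
Variable S : SCG_run A b.

Local Notation p := (scg_p S).
Local Notation q := (scg_q S).
Local Notation r := (scg_r S).

Lemma scg_qE k : produced r k.+1 -> q k = A *m p k.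
Proof.
elim/ltn_ind: k => -[|k] IH rk; first by case: (scg_init S).
have rk1 : produced r k.+1 by apply: producedW rk.
have [|lam [_ -> ->]] := scg_direction rk1; first by apply: rk.
rewrite mulmxBr mulmxA; congr (_ - _ *m _); apply/matrixP => i j.
rewrite !mxE IH //; last by apply: producedW rk; apply: ltnW (ltn_ord j).
by rewrite mxE; apply: eq_bigr => m _; rewrite !mxE.
Qed.

(** The system solved by [lam] says exactly that [P^T] annihilates the new [q]. *)
Lemma scg_semiconjugate k j : produced r k.+1 -> (j < k)%N ->
  dot (p j) (A *m p k) = 0.
Proof.
case: k => // k rk jk; rewrite -scg_qE //.
have rk1 : produced r k.+1 by apply: producedW rk.
have [|lam [Llam _ ->]] := scg_direction rk1; first by apply: rk.
rewrite -(tr_colseq_mulmx p _ (Ordinal jk)) mulmxBr (mulmxA _ (colseq _ _)) Llam.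
by rewrite subrr mxE.
Qed.

Lemma dot_scg_direction k y : produced r k.+1 ->
  (forall j, (j < k)%N -> dot (p j) y = 0) -> dot (p k) y = dot (r k) y.
Proof.
case: k => [|k] rk py; first by case: (scg_init S) => _ _ ->.
have rk1 : produced r k.+1 by apply: producedW rk.
have [|lam [_ -> _]] := scg_direction rk1; first by apply: rk.
rewrite dotBl colseq_mulmx (dotC (\sum_(_ < _) _)) dot_sumr big1 ?subr0 // => j _.
by rewrite dotZr dotC py ?mulr0.
Qed.

End SCG.

(** * Comparison of the two methods *)

Lemma fom_scg_step (R : realType) (n : nat) (A : 'M[R]_n) (b : 'cV[R]_n)
    (hA : posdef A) (F : FOM_run A b) (S : SCG_run A b) (k : nat) :
  produced (fom_r F) k.+1 -> produced (scg_r S) k.+1 ->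
  exists a : R,
    [/\ a != 0, fom_p F k.+1 = a *: scg_p S k & fom_r F k.+1 = scg_r S k.+1].
Proof.
elim/ltn_ind: k => k IH rF rS.
have rk : fom_r F k = scg_r S k.
  case: k IH rF rS => [|k] IH rF rS.
    by case: (fom_init F) => _ -> _; case: (scg_init S) => _ ->.
  by case: (IH k) => [//|||a []]; [apply: producedW rF | apply: producedW rS |].
have u0 := fom_u_gt0 rF; have rkE := fom_residualE rF.
have z0 : fom_zeta F k.+1 != 0.
  have : fom_r F k != 0 by apply: rF.
  by apply: contraNneq => z0; rewrite rkE z0 scale0r.
(* Modulo earlier directions, the FOM direction is [v / u] and the SCG one is [r = zeta v]; this
   ratio makes them agree. *)
pose a := (fom_zeta F k.+1 * fom_u F k.+1 k.+1)^-1.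
have a0 : a != 0 by rewrite /a invr_eq0 mulf_neq0 // gt_eqF.
have az : a * fom_zeta F k.+1 = (fom_u F k.+1 k.+1)^-1.
  by rewrite /a invfM mulrAC mulVf // mul1r.
have pj j : (j < k)%N -> exists2 c, c != 0 & fom_p F j.+1 = c *: scg_p S j.
  move=> jk; have jk1 : (j.+1 <= k.+1)%N by apply: ltnW.
  have [c [c0 pc _]] := IH j jk (producedW jk1 rF) (producedW jk1 rS).
  by exists c.
have pE : fom_p F k.+1 = a *: scg_p S k.
  apply/eqP; rewrite -subr_eq0; apply/eqP; set d := _ - _.
  apply: (posdef_dot_eq0 hA).
  have dF j : (j < k)%N -> dot (fom_p F j.+1) (A *m d) = 0.
    move=> jk; rewrite mulmxBr dotBr fom_semiconjugate // -scalemxAr dotZr.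
    have [c _ ->] := pj j jk.
    by rewrite dotZl scg_semiconjugate // !mulr0 subrr.
  have dS j : (j < k)%N -> dot (scg_p S j) (A *m d) = 0.
    move=> jk; have := dF j jk; have [c c0 ->] := pj j jk.
    by rewrite dotZl => /eqP; rewrite mulf_eq0 (negbTE c0) => /eqP.
  (* Against [A *m d], earlier directions drop out of [d], leaving [v / u - a r], which is zero. *)
  rewrite {1}/d dotBl dotZl dot_fom_direction // dot_scg_direction //.
  by rewrite -rk rkE dotZl mulrA az subrr.
exists a; split => //.
have [_ rF1] := fom_update (ltn0Sn k) rF; have [_ ->] := scg_update rS.
have orth := dot_fom_direction_residual rF; rewrite rF1 /= in orth *.
rewrite rk scg_qE // pE in orth *; rewrite -scalemxAr scalerA.
(* The denominator of the SCG step length is nonzero, since the SCG direction inherits nonvanishing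
   from the FOM one. *)
have pAp : dot (scg_p S k) (A *m scg_p S k) != 0.
  rewrite gt_eqF // hA //; apply: contraNneq (fom_direction_neq0 rF) => p0.
  by rewrite pE p0 scaler0.
(* Both step lengths along [scg_p S k] solve the same linear equation: the new residual is
   orthogonal to that direction. *)
congr (_ - _ *: _); apply: (mulIf pAp); rewrite divfK //.
move: orth; rewrite dotZl dotBr -scalemxAr !dotZr => /eqP.
by rewrite mulf_eq0 (negbTE a0) /= subr_eq0 mulrA => /eqP.
Qed.

Theorem theorem2p2 (R : realType) (n : nat) (A : 'M[R]_n) (b : 'cV[R]_n)
    (hA : posdef A) (F : FOM_run A b) (S : SCG_run A b) (k : nat)
    (hk : (1 <= k)%N)
    (hFprod : produced (fom_r F) k.-1) (hF : fom_r F k.-1 != 0)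
    (hSprod : produced (scg_r S) k.-1) (hS : scg_r S k.-1 != 0) :
  exists a : R,
    [/\ a != 0, fom_p F k = a *: scg_p S k.-1 & fom_r F k = scg_r S k].
Proof.
case: k hk hFprod hF hSprod hS => // k _ /= hFprod hF hSprod hS.
(* [produced r k] and [r k != 0] together amount to [produced r k.+1]. *)
by apply: fom_scg_step => // j; rewrite ltnS leq_eqVlt => /predU1P[->//|];
  [exact: hFprod | exact: hSprod].
Qed.
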